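(* Let $L_{aug}=\Sigma_{aug}C_{aug}^TW^{-1}$, where $\Sigma_{aug}$ is the unique positive definite solution to $$0=A_{aug}\Sigma_{aug}+\Sigma_{aug}A_{aug}^T+E_{aug}VE_{aug}^T-\Sigma_{aug}C_{aug}^TW^{-1}C_{aug}\Sigma_{aug},$$ let $A_{aug}^{CL}=A_{aug}-L_{aug}C_{aug}$, and let $L=\Sigma C^TW^{-1}$, where $\Sigma$ is the unique positive definite solution to $$0=A\Sigma+\Sigma A^T-\Sigma C^TW^{-1}C\Sigma+EVE^T.$$ Assume that the eigenvalues of $A_N$, $A$, and $A-LC$ are disjoint. Then the $N$ eigenvalues of $A_{aug}^{CL}$ that are identical to those of $A_N$ are uncontrollable eigenvalues of $(A_{aug},L_{aug})$. Furthermore, a minimal realization of $$L_{est}^{aug}(s)=C_{aug}(sI_{n+N}-A_{aug})^{-1}L_{aug}$$ is given by $(A,L,C)$, with transfer function $L_{est}(s)=C(sI_n-A)^{-1}L$.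
   Context: Let $n,N\ge1$ be integers, $\tau>0$, $A\in\mathbb{R}^{n\times n}$, $B,E\in\mathbb{R}^{n\times1}$, $C\in\mathbb{R}^{1\times n}$, with $(A,C)$ observable and $(A,B)$, $(A,E)$ controllable. $V\ge0$ and $W>0$ are real scalars (covariances of the zero-mean Gaussian white process disturbance and measurement noise). $P_N(s)$ denotes the $N$-th order (diagonal) Padé approximation of $e^{-s\tau}$: $P_N(s)=Q_N(-s)/Q_N(s)$ with $Q_N(s)=\sum_{k=0}^N\frac{(2N-k)!\,N!}{(2N)!\,k!\,(N-k)!}(\tau s)^k$. It has $N$ zeros in the open right half plane and $N$ distinct poles, located at the negatives of those zeros, and it is allpass: $P_N(s)P_N(-s)=1$. $(A_N,B_N,C_N,D_N)$ is a minimal real realization, $P_N(s)=C_N(sI_N-A_N)^{-1}B_N+D_N$, $A_N\in\mathbb{R}^{N\times N}$. Define $$A_{aug}=\begin{bmatrix}A&0_{n\times N}\\ B_NC&A_N\end{bmatrix},\qquad E_{aug}=\begin{bmatrix}E\\ 0_{N\times1}\end{bmatrix},\qquad C_{aug}=\begin{bmatrix}D_NC&C_N\end{bmatrix}.$$ It is assumed that $(A_{aug},C_{aug})$ is observable and $(A_{aug},E_{aug})$ is controllable. Under these assumptions $A_{aug}^{CL}$ has $N$ eigenvalues identical to those of $A_N$ and $n$ eigenvalues identical to those of $A-LC$. $\lambda$ is an uncontrollable eigenvalue of a pair $(F,G)$, $F$ being $p\times p$, if $\operatorname{rank}[\lambda I-F\ \ G]<p$. A realization is minimal if it is controllable and observable.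 *)

(* Defs.v *)
From HB Require Import structures.
From mathcomp Require Import all_boot all_order all_algebra.
From mathcomp Require Import complex.
From mathcomp Require Import reals.

Set Implicit Arguments.
Unset Strict Implicit.
Unset Printing Implicit Defensive.

Import Order.TTheory GRing.Theory Num.Theory.
Local Open Scope ring_scope.

Local Notation "x %:F" := (@tofrac _ x) : ring_scope.

Notation toC R := (map_mx (real_complex R)).

(* Rational functions over R in one indeterminate s, namely 'X%:F. *)
Notation ratfun R := {fraction {poly R}}.

Definition ratfun_mx (R : realType) m n (F : 'M[R]_(m, n)) :
    'M[ratfun R]_(m, n) :=
  map_mx (@tofrac {poly R} \o polyC) F.

(* H (sI - F)^-1 G + D as a matrix of rational functions of s.  The matrix
   sI - F is always invertible over the field of rational functions. *)
Definition transfer (R : realType) p m q (F : 'M[R]_p) (G : 'M[R]_(p, m))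
    (H : 'M[R]_(q, p)) (D : 'M[R]_(q, m)) : 'M[ratfun R]_(q, m) :=
  ratfun_mx H *m invmx (('X%:F)%:M - ratfun_mx F) *m ratfun_mx G
  + ratfun_mx D.

(* Kalman rank condition: rank [G, F G, ..., F^(p-1) G] = p. *)
Definition controllable (R : realType) p m (F : 'M[R]_p) (G : 'M[R]_(p, m)) :=
  \rank (\mxrow_(i < p) (F ^+ i *m G)) = p.

(* Kalman rank condition: rank [H; H F; ...; H F^(p-1)] = p. *)
Definition observable (R : realType) p q (F : 'M[R]_p) (H : 'M[R]_(q, p)) :=
  \rank (\mxcol_(i < p) (H *m F ^+ i)) = p.

Definition minimal_realization (R : realType) p m q (F : 'M[R]_p)
    (G : 'M[R]_(p, m)) (H : 'M[R]_(q, p)) (D : 'M[R]_(q, m))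
    (T : 'M[ratfun R]_(q, m)) : Prop :=
  [/\ transfer F G H D = T, controllable F G & observable F H].

(* Eigenvalues of a real matrix are its complex eigenvalues. *)
Definition eigenval (R : realType) p (F : 'M[R]_p) (lambda : R[i]) : bool :=
  eigenvalue (toC R F) lambda.

Definition disjoint_spectra (R : realType) p q (F : 'M[R]_p) (G : 'M[R]_q) :
    Prop :=
  forall lambda : R[i], ~ (eigenval F lambda /\ eigenval G lambda).

(* rank [lambda I - F, G] < p.  When it holds, lambda is automatically an
   eigenvalue of F. *)
Definition uncontrollable_eigenvalue (R : realType) p m (F : 'M[R]_p)
    (G : 'M[R]_(p, m)) (lambda : R[i]) : Prop :=
  (\rank (row_mx (lambda%:M - toC R F) (toC R G)) < p)%N.

Definition posdef (R : realType) p (S : 'M[R]_p) : Prop :=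
  S^T = S /\ forall x : 'cV[R]_p, x != 0 -> 0 < (x^T *m S *m x) 0 0.

(* 0 = F S + S F^T + E V E^T - S H^T W^-1 H S, with V and W scalars. *)
Definition filter_riccati (R : realType) p (F : 'M[R]_p) (E : 'cV[R]_p)
    (H : 'rV[R]_p) (V W : R) (S : 'M[R]_p) : Prop :=
  0 = F *m S + S *m F^T + V *: (E *m E^T) - W^-1 *: (S *m H^T *m H *m S).

Definition unique_posdef_solution (R : realType) p (F : 'M[R]_p)
    (E : 'cV[R]_p) (H : 'rV[R]_p) (V W : R) (S : 'M[R]_p) : Prop :=
  unique (fun S' => posdef S' /\ filter_riccati F E H V W S') S.

Definition pade_den (R : realType) (N : nat) (tau : R) : {poly R} :=
  \poly_(k < N.+1)
    (((2 * N - k)`! * N`!)%:R / ((2 * N)`! * k`! * (N - k)`!)%:R * tau ^+ k).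

(* Q_N(-s) / Q_N(s), the diagonal Pade approximation of exp(- s tau). *)
Definition pade (R : realType) (N : nat) (tau : R) : ratfun R :=
  (pade_den N tau \Po - 'X)%:F / (pade_den N tau)%:F.

(* Main.v *)
Require Import Defs.
From HB Require Import structures.
From mathcomp Require Import all_boot all_order all_algebra.
From mathcomp Require Import complex.
From mathcomp Require Import reals.
From mathcomp Require Import ring lra zify.

Set Implicit Arguments.
Unset Strict Implicit.
Unset Printing Implicit Defensive.

Import Order.TTheory GRing.Theory Num.Theory.
Local Open Scope ring_scope.

(** The argument compares two spectral factorisations.  Write [a], [a_N] for
the characteristic polynomials of [A], [A_N], write [f], [f_aug] for those of
[A - LC] and of the augmented closed loop, [e] for the numerator of
[C (s - A)^-1 E], and [p~] for [p(-s)].  A filter Riccati equation yields the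
polynomial identity [W f f~ = W a a~ + V e e~]
([riccati_spectral_factorization]).  The augmented plant is the cascade of the
plant and of the Pade approximant [a_N~ / a_N], so it has denominator [a a_N]
and numerator [a_N~ e] ([tf_num_cascade]); as the approximant is allpass, the
augmented right-hand side is [a_N a_N~] times the original one, whence
[f_aug f_aug~ = (a_N f) (a_N f)~].

Both [f_aug] and [a_N f] are monic and have all their roots in the open left
half plane, so they are equal ([spectral_factor_unique]).  For [f] and [f_aug]
this is Lyapunov's argument applied to the positive definite Riccati solution
([riccati_closed_loop_hurwitz]).  It needs [0 < V], which holds because the
augmented plant has a stable eigenvalue ([riccati_driven]).  For [a_N] it is
the stability of the Pade denominator ([hurwitz_pade_den]), which follows from
the three-term recurrence of the reverse Bessel polynomials.

Everything is read off [f_aug = a_N f].  Since [1 + C (s - A)^-1 L = f / a],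
the two loop transfer functions coincide.  An eigenvalue of [A_N] is an
eigenvalue of the augmented plant both before and after output injection,
which for an observable pair makes it uncontrollable from the injection gain
([common_eigenvalue_uncontrollable]).  Finally [(A, L)] is controllable
because [A] and [A - LC] have no common eigenvalue
([disjoint_controllable]). *)

Local Notation toCp R := (map_poly (real_complex R)).
Local Notation para p := (p \Po - 'X).
Local Notation "M %:cM" := (map_mx polyC M) (at level 2, format "M %:cM").
Local Notation "x %:F" := (@tofrac _ x) : ring_scope.
Local Notation "v ^h" := (map_mx conjc v)^T (at level 8, format "v ^h").

(** * Hurwitz polynomials *)

Definition hurwitz (R : realType) (p : {poly R}) : Prop :=
  forall z : R[i], root (toCp R p) z -> complex.Re z < 0.

Lemma paraK (K : comNzRingType) (p : {poly K}) : para (para p) = p.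
Proof. by rewrite -comp_polyA rmorphN /= comp_polyX opprK comp_polyXr. Qed.

(** Replacing [s] by [-s] reflects the roots into the right half plane. *)
Lemma hurwitz_para_root (R : realType) (p : {poly R}) (z : R[i]) :
  hurwitz p -> root (toCp R (para p)) z -> 0 < complex.Re z.
Proof.
move=> hp; rewrite rootE map_comp_poly horner_comp rmorphN /= map_polyX hornerN
  hornerX.
by move=> /hp; case: z => x y /=; rewrite oppr_lt0.
Qed.

(** Coprimality is insensitive to field extension, and over the algebraically
closed field [R[i]] it is the absence of common roots. *)
Lemma coprimep_no_common_root (R : realType) (p q : {poly R}) :
  (forall z : R[i], root (toCp R p) z -> ~~ root (toCp R q) z) -> coprimep p q.
Proof.
move=> pq; rewrite -(coprimep_map (real_complex R)).
by apply: Pdiv.ClosedField.root_coprimep => z /pq.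
Qed.

Lemma hurwitz_coprime_para (R : realType) (p q : {poly R}) :
  hurwitz p -> hurwitz q -> coprimep p (para q).
Proof.
move=> hp hq; apply: coprimep_no_common_root => z /hp z_lt0; apply/negP.
by move=> /(hurwitz_para_root hq); rewrite ltNge (ltW z_lt0).
Qed.

Lemma hurwitz_mul (R : realType) (p q : {poly R}) :
  hurwitz p -> hurwitz q -> hurwitz (p * q).
Proof. by move=> hp hq z; rewrite rmorphM rootM => /orP[/hp | /hq]. Qed.

Lemma hurwitz_scale (R : realType) (c : R) (p : {poly R}) :
  c != 0 -> hurwitz p -> hurwitz (c *: p).
Proof. by move=> c0 hp z; rewrite map_polyZ rootZ ?fmorph_eq0 // => /hp. Qed.

(** [p] is coprime to [q~], which has its roots on the other side, so it must
divide [q]; by symmetry [q] divides [p]. *)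
Lemma spectral_factor_unique (R : realType) (p q : {poly R}) :
  p \is monic -> q \is monic -> hurwitz p -> hurwitz q ->
  p * para p = q * para q -> p = q.
Proof.
move=> mp mq hp hq e; apply/eqP; rewrite -eqp_monic //; apply/andP; split.
  rewrite -(Gauss_dvdpl _ (hurwitz_coprime_para hp hq)) -e.
  exact: dvdp_mulr.
rewrite -(Gauss_dvdpl _ (hurwitz_coprime_para hq hp)) e.
exact: dvdp_mulr.
Qed.

(** * Stability of the Pade denominator *)

(** The coefficients of the Pade denominator of [exp(-s)] cleared of the factor
[N! / (2N)!]: the reverse Bessel polynomial at [s / 2], up to the factor [2^N].
*)
Definition bessel (R : realType) (N : nat) : {poly R} :=
  \poly_(k < N.+1) ((2 * N - k)`!%:R / (k`! * (N - k)`!)%:R).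

Lemma fact_neq0 (R : realType) m : m`!%:R != 0 :> R.
Proof. by rewrite pnatr_eq0 -lt0n fact_gt0. Qed.

(** The recurrence makes stability a positivity argument: it is compared
coefficient by coefficient, the extreme coefficients being separate because one
of the three factorial quotients is absent there. *)
Lemma bessel_rec (R : realType) N :
  bessel R N.+2 = (4 * N + 6)%:R *: bessel R N.+1 + 'X^2 * bessel R N.
Proof.
apply/polyP => k; rewrite coefD coefZ coefXnM !coef_poly.
have f0 := @fact_neq0 R.
have M0 : 0 <= N%:R :> R by exact: ler0n.
case: k => [|[|k]].
- rewrite !ltn0Sn !subn0 addr0 fact0 !mul1n.
  have -> : (2 * N.+2 = (2 * N.+1).+2)%N by lia.
  rewrite (factS (2 * N.+1).+1) (factS (2 * N.+1)) (factS N.+1).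
  move: (f0 N.+1); move: (N.+1`!) ((2 * N.+1)`!) => x y hx.
  by field; rewrite hx /=; apply: lt0r_neq0; lra.
- rewrite addr0 !ltnS !leq0n.
  have -> : (2 * N.+2 - 1 = (2 * N).+3)%N by lia.
  have -> : (2 * N.+1 - 1 = (2 * N).+1)%N by lia.
  rewrite (subn1 N.+2) (subn1 N.+1) (_ : 1`! = 1)%N // !mul1n.
  rewrite (factS (2 * N).+2) (factS (2 * N).+1) (factS N).
  move: (f0 N); move: (N`!) ((2 * N).+1`!) => x y hx.
  by field; rewrite hx /=; apply: lt0r_neq0; lra.
have -> : (k.+2 - 2 = k)%N by lia.
rewrite !ltnS (subSS k.+1 N.+1) !(subSS k N) (subSS k.+1 N).
case: (ltngtP k N) => [lt_kN | lt_Nk | ->]; last 2 first.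
- by rewrite mulr0 addr0.
- rewrite ltn0 mulr0 add0r subnn fact0 !muln1.
  have -> : (2 * N.+2 - N.+2 = N.+2)%N by lia.
  have -> : (2 * N - N = N)%N by lia.
  by rewrite !divff.
have [m ->] : exists m, N = (k + m).+1 by exists (N - k.+1)%N; lia.
have -> : (2 * (k + m).+3 - k.+2 = (k + 2 * m).+4)%N by lia.
have -> : (2 * (k + m).+2 - k.+2 = (k + 2 * m).+2)%N by lia.
have -> : (2 * (k + m).+1 - k = (k + 2 * m).+2)%N by lia.
have -> : ((k + m).+1 - k = m.+1)%N by lia.
have -> : ((k + m).+1 - k.+1 = m)%N by lia.
rewrite ltn0.
rewrite (factS (_ + _).+3) (factS (_ + _).+2).
rewrite (factS k.+1) (factS k) (factS m).
move: (f0 k) (f0 m); move: (k`!) (m`!) ((k + 2 * m).+2`!) => x y z hx hy.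
have k0 : 0 <= k%:R :> R by exact: ler0n.
have m0 : 0 <= m%:R :> R by exact: ler0n.
by field; rewrite hx hy /=; apply/and3P; split; apply: lt0r_neq0; lra.
Qed.

Lemma bessel0 (R : realType) : bessel R 0 = 1.
Proof.
apply/polyP => -[|k]; rewrite coef_poly coef1 /=; last by [].
by rewrite divr1.
Qed.

Lemma bessel1 (R : realType) : bessel R 1 = 2%:R%:P + 'X.
Proof.
apply/polyP => -[|[|k]]; rewrite coef_poly coefD coefC coefX //=.
- by rewrite divr1 addr0.
- by rewrite divr1 add0r.
- by rewrite addr0.
Qed.

Lemma sqr_norm_gt0 (R : realType) (x y : R) :
  (x != 0) || (y != 0) -> 0 < x ^+ 2 + y ^+ 2.
Proof.
move=> xy0; rewrite lt0r addr_ge0 ?sqr_ge0 // paddr_eq0 ?sqr_ge0 //.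
by rewrite !sqrf_eq0 negb_and xy0.
Qed.

(** With [r_N = b_(N+1) / (z b_N)] the recurrence reads
[r_(N+1) = (4N + 6) / z + 1 / r_N], and both terms keep a positive real part
when [r_N] has one and [0 <= Re z].  Multiplying by conjugates instead of
dividing avoids assuming that [b_N] does not vanish, which is what the lemma is
used to prove. *)
Lemma bessel_re_gt0 (R : realType) N (z : R[i]) :
  0 <= complex.Re z -> z != 0 ->
  0 < complex.Re ((toCp R (bessel R N.+1)).[z]
                  * conjc (z * (toCp R (bessel R N)).[z])).
Proof.
move=> re_z z0; elim: N => [|N IH].
  rewrite bessel0 bessel1 rmorph1 rmorphD /= map_polyC map_polyX !hornerE /=.
  move: re_z z0; case: z => x y /=; rewrite eq_complex /= negb_and => x0 xy0.
  have : 0 < x ^+ 2 + y ^+ 2 by exact: sqr_norm_gt0.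
  by nra.
rewrite bessel_rec rmorphD rmorphM /= map_polyZ map_polyXn hornerD hornerM
  hornerZ hornerXn.
set c : R := (4 * N + 6)%:R.
have c0 : 0 <= c by exact: ler0n.
move: re_z z0 IH c c0.
case: (_.[z]) => p q; case: (_.[z]) => r s; case: z => x y /=.
rewrite eq_complex /= negb_and => x0 xy0 IH c c0.
have n0 : 0 < x ^+ 2 + y ^+ 2 by exact: sqr_norm_gt0.
have m0 : 0 <= p ^+ 2 + q ^+ 2 by rewrite addr_ge0 ?sqr_ge0.
(* The real part is [(4N + 6) Re z |p|^2 + |z|^2 Re (p conj (z r))]. *)
have := mulr_gt0 n0 IH; have := mulr_ge0 c0 (mulr_ge0 x0 m0).
move=> h1 h2; apply: lt_le_trans (ltr_wpDl h1 h2) _.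
by rewrite le_eqVlt; apply/orP; left; apply/eqP; ring.
Qed.

Lemma pade_den_horner (R : realType) N (tau : R) (z : R[i]) :
  (toCp R (pade_den N tau)).[z] =
  real_complex R (N`!%:R / (2 * N)`!%:R)
  * (toCp R (bessel R N)).[real_complex R tau * z].
Proof.
rewrite !(@horner_coef_wide _ N.+1) ?size_map_poly ?size_poly // mulr_sumr.
apply: eq_bigr => -[k /= ltkN] _; rewrite !coef_map !coef_poly ltkN.
rewrite exprMn -rmorphXn mulrA [RHS]mulrA -!rmorphM;
  congr (real_complex R _ * _).
by rewrite !natrM; field; rewrite !fact_neq0.
Qed.

Lemma hurwitz_pade_den (R : realType) N (tau : R) :
  0 < tau -> hurwitz (pade_den N tau).
Proof.
move=> tau0 z; rewrite rootE pade_den_horner mulf_eq0 fmorph_eq0 mulf_eq0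
  invr_eq0.
rewrite !(negPf (fact_neq0 _ _)) /=.
set w := _ * z => w_root; rewrite ltNge; apply/negP => z_ge0.
have w_ge0 : 0 <= complex.Re w.
  by rewrite /w; case: (z) z_ge0 => x y /= x0;
    rewrite mul0r subr0 mulr_ge0 // ltW.
case: N w_root => [|N]; first by rewrite bessel0 rmorph1 hornerE oner_eq0.
(* At [w = 0] the recurrence is no help, but the constant term is positive. *)
have [-> | w0 w_root] := eqVneq w 0; last first.
  by have := bessel_re_gt0 N w_ge0 w0; rewrite (eqP w_root) mul0r ltxx.
rewrite horner_coef0 coef_map fmorph_eq0 coef_poly.
by rewrite mulf_eq0 invr_eq0 natrM mulf_eq0 !(negPf (fact_neq0 _ _)).
Qed.


Lemma size_pade_den (R : realType) N (tau : R) :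
  0 < tau -> size (pade_den N tau) = N.+1.
Proof.
move=> tau0; apply: size_poly_eq.
rewrite !natrM; apply: mulf_neq0; last exact/expf_neq0/lt0r_neq0.
by rewrite mulf_neq0 ?invr_neq0 ?mulf_neq0 ?fact_neq0.
Qed.

(** * Transfer functions as quotients of polynomials *)

(** The numerator of [H (s - F)^-1 G] over the denominator [char_poly F]. *)
Definition tf_num (K : fieldType) p (F : 'M[K]_p) (G : 'cV[K]_p)
    (H : 'rV[K]_p) : {poly K} :=
  (H%:cM *m \adj (char_poly_mx F) *m G%:cM) 0 0.

Lemma transferE (R : realType) p (F : 'M[R]_p) (G : 'cV[R]_p) (H : 'rV[R]_p)
    (D : 'M[R]_1) :
  transfer F G H D =
  ((tf_num F G H + D 0 0 *: char_poly F)%:F / (char_poly F)%:F)%:M.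
Proof.
have a0 : (char_poly F)%:F != 0
  by rewrite tofrac_eq0 monic_neq0 ?char_poly_monic.
have toF m q (M : 'M[R]_(m, q)) : ratfun_mx M = map_mx (@tofrac _) M%:cM.
  by apply/matrixP => i j; rewrite !mxE.
have XE : ('X%:F)%:M - ratfun_mx F = map_mx (@tofrac _) (char_poly_mx F).
  by rewrite map_mxB map_scalar_mx toF.
rewrite /transfer XE !toF [LHS]mx11_scalar; congr _%:M.
rewrite /invmx unitmxE det_map_mx unitfE a0 -map_mx_adj.
rewrite -scalemxAr -scalemxAl -!map_mxM !mxE rmorphD /= mulrDl.
rewrite [in RHS]mulrC; congr (_ + _); first by rewrite /tf_num mxE.
by rewrite -mul_polyC rmorphM /= mulfK.
Qed.

(** Two block eliminations of the same bordered matrix, whose determinant is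
thus computed as either side; the second one multiplies it by [\det M], which
is cancelled. *)
Lemma det_rank1_update (K : idomainType) p (M : 'M[K]_p) (u : 'cV[K]_p)
    (v : 'rV[K]_p) :
  \det M != 0 -> \det (M + u *m v) = \det M + (v *m \adj M *m u) 0 0.
Proof.
move=> M0; apply: (mulfI M0).
pose B := block_mx M (- u) v (1%:M : 'M_1).
have detB : \det B = \det (M + u *m v).
  have -> : B = block_mx (M + u *m v) (- u) 0 1%:M *m block_mx 1%:M 0 v 1%:M.
    by rewrite mulmx_block !mulmx1 !mul0mx !mul1mx !mulmx0 mulNmx addrK !add0r.
  by rewrite det_mulmx det_ublock det_lblock !det1 !mulr1.
rewrite -detB.
have: block_mx 1%:M 0 (- (v *m \adj M)) (\det M)%:M *m B
      = block_mx M (- u) 0 ((\det M)%:M + v *m \adj M *m u).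
  rewrite mulmx_block !mul1mx !mul0mx !addr0 !mulNmx -[v *m _ *m M]mulmxA
    mul_adj_mx.
  by rewrite mul_mx_scalar mul_scalar_mx addNr mulmxN opprK mulmx1 addrC.
move/(congr1 determinant).
by rewrite det_mulmx det_lblock det_ublock det1 mul1r !det_mx11 !mxE /= mulr1n.
Qed.

Lemma char_poly_feedback (K : fieldType) p (F : 'M[K]_p) (G : 'cV[K]_p)
    (H : 'rV[K]_p) :
  char_poly (F - G *m H) = char_poly F + tf_num F G H.
Proof.
rewrite /char_poly.
have -> : char_poly_mx (F - G *m H) = char_poly_mx F + G%:cM *m H%:cM.
  by rewrite /char_poly_mx map_mxB map_mxM opprB addrA addrAC.
by rewrite det_rank1_update // monic_neq0 ?char_poly_monic.
Qed.

Lemma char_poly_mx_lblock (K : fieldType) m n (A : 'M[K]_m) (X : 'M[K]_(n, m))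
    (D : 'M[K]_n) :
  char_poly_mx (block_mx A 0 X D) =
  block_mx (char_poly_mx A) 0 (- X%:cM) (char_poly_mx D).
Proof.
rewrite /char_poly_mx map_block_mx map_mx0 scalar_mx_block opp_block_mx.
by rewrite add_block_mx !oppr0 !add0r.
Qed.

Lemma char_poly_lblock (K : fieldType) m n (A : 'M[K]_m) (X : 'M[K]_(n, m))
    (D : 'M[K]_n) :
  char_poly (block_mx A 0 X D) = char_poly A * char_poly D.
Proof. by rewrite /char_poly char_poly_mx_lblock det_lblock. Qed.

(** Block triangularity lets the cascade be solved by forward substitution: the
explicit vector [z] below solves [Z z = det Z * col_mx E 0], so it is the
adjugate of [Z] applied to [col_mx E 0]. *)
Lemma tf_num_cascade (K : fieldType) m n (A : 'M[K]_m) (E : 'cV[K]_m)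
    (C : 'rV[K]_m) (F : 'M[K]_n) (G : 'cV[K]_n) (H : 'rV[K]_n) (D : 'M[K]_1) :
  tf_num (block_mx A 0 (G *m C) F) (col_mx E 0) (row_mx (D *m C) H) =
  (tf_num F G H + D 0 0 *: char_poly F) * tf_num A E C.
Proof.
pose X := char_poly_mx A; pose Y := char_poly_mx F.
pose Z := char_poly_mx (block_mx A 0 (G *m C) F).
pose a := char_poly A; pose b := char_poly F.
have ab0 : a * b != 0 by rewrite mulf_neq0 ?monic_neq0 ?char_poly_monic.
pose z := col_mx (b *: (\adj X *m E%:cM))
                 (\adj Y *m G%:cM *m (C%:cM *m \adj X *m E%:cM)).
have Zz : Z *m z = (a * b) *: (col_mx E 0)%:cM.
  rewrite /Z /z char_poly_mx_lblock mul_block_col mul0mx addr0 map_col_mx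
    map_mx0.
  rewrite scale_col_mx scaler0; congr col_mx.
    by rewrite -scalemxAr mulmxA mul_mx_adj mul_scalar_mx scalerA mulrC.
  rewrite !mulmxA mul_mx_adj -!mulmxA mul_scalar_mx map_mxM -scalemxAr mulNmx
    scalerN.
  by rewrite -!mulmxA addNr.
have adjE : \adj Z *m (col_mx E 0)%:cM = z.
  have : (a * b) *: (\adj Z *m (col_mx E 0)%:cM) = (a * b) *: z.
    rewrite scalemxAr -Zz mulmxA mul_adj_mx mul_scalar_mx.
    by rewrite -/(char_poly _) char_poly_lblock.
  move=> /matrixP eq_ab; apply/matrixP => i j; apply: (mulfI ab0).
  by have := eq_ab i j; rewrite !mxE.
rewrite /tf_num -mulmxA adjE map_row_mx mul_row_col map_mxM -scalemxAr.
rewrite [D]mx11_scalar map_scalar_mx mul_scalar_mx -!scalemxAl.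
rewrite !mulmxA.
have -> : H%:cM *m \adj Y *m G%:cM = (tf_num F G H)%:M.
  by rewrite [LHS]mx11_scalar.
rewrite -!mulmxA mul_scalar_mx !mulmxA.
have -> : C%:cM *m \adj X *m E%:cM = (tf_num A E C)%:M.
  by rewrite [LHS]mx11_scalar.
rewrite !mxE /= !mulr1n -mul_polyC -/b.
by ring.
Qed.

(** The Pade denominator [Q] is coprime to its numerator [Q~] and has degree
[N], so a realisation of order [N] has a characteristic polynomial proportional
to [Q]; the transfer function then forces its numerator to be
[para (char_poly F)]. *)
Lemma pade_realization_allpass (R : realType) N (tau : R) (F : 'M[R]_N)
    (G : 'cV[R]_N) (H : 'rV[R]_N) (D : 'M[R]_1) :
  0 < tau -> transfer F G H D = (pade N tau)%:M ->
  hurwitz (char_poly F) /\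
  tf_num F G H + D 0 0 *: char_poly F = para (char_poly F).
Proof.
move=> tau0; rewrite transferE => /matrixP/(_ 0 0);
  rewrite !mxE /= !mulr1n /pade.
set P := _ + _; set a := char_poly F; set Q := pade_den N tau => /eqP.
have hQ : hurwitz Q by exact: hurwitz_pade_den.
have a0 : a != 0 by rewrite monic_neq0 ?char_poly_monic.
have Q0 : Q != 0 by rewrite -size_poly_eq0 size_pade_den.
rewrite eqr_div ?tofrac_eq0 // -!rmorphM tofrac_eq => /eqP PQ.
have Q_dvd_a : Q %| a.
  by rewrite -(Gauss_dvdpr _ (hurwitz_coprime_para hQ hQ)) -PQ dvdp_mull.
have : Q %= a by rewrite -dvdp_size_eqp // size_char_poly size_pade_den.
move/eqp_eq; rewrite (monicP (char_poly_monic F)) scale1r.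
set k := lead_coef Q => QE; have k0 : k != 0 by rewrite lead_coef_eq0.
split.
  have -> : a = k^-1 *: Q by rewrite QE scalerA mulVf // scale1r.
  by apply: hurwitz_scale; rewrite ?invr_eq0.
by apply: (mulIf Q0); rewrite PQ QE linearZ /= -scalerAl -scalerAr.
Qed.

(** * Spectral factorisation from the Riccati equation *)

(** With [X = s - F], the Riccati equation says
[X S + S X~^T = V E E^T - W L L^T].  Multiplying by [H adj X] on the left and by
its image under [s -> -s], transposed, on the right turns the left-hand side
into [W (a l~ + a~ l)], where [l] is the numerator of [H X^-1 L] and
[f = a + l]. *)
Lemma riccati_spectral_factorization (R : realType) p (F : 'M[R]_p)
    (E : 'cV[R]_p) (H : 'rV[R]_p) (V W : R) (S : 'M[R]_p) :
  W != 0 -> S^T = S -> filter_riccati F E H V W S ->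
  let L := W^-1 *: (S *m H^T) in
  let f := char_poly (F - L *m H) in
  W *: (f * para f) =
  W *: (char_poly F * para (char_poly F)) +
  V *: (tf_num F E H * para (tf_num F E H)).
Proof.
move=> W0 symS ric L f.
have HS : H *m S = W *: L^T.
  by rewrite /L linearZ /= trmx_mul trmxK symS scalerA divff // scale1r.
have SH : S *m H^T = W *: L by rewrite scalerA divff // scale1r.
have lyap : F *m S + S *m F^T = W *: (L *m L^T) - V *: (E *m E^T).
  move: ric; rewrite /filter_riccati SH -mulmxA HS -scalemxAl -scalemxAr
    !scalerA.
  rewrite mulVf // mul1r => /esym/eqP; rewrite subr_eq0 => /eqP <-.
  by rewrite addrK.
pose X := char_poly_mx F; pose P := \adj X.
pose a := char_poly F; pose l := tf_num F L H; pose e := tf_num F E H.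
have para_cM m q (M : 'M[R]_(m, q)) : map_mx (comp_poly (- 'X)) M%:cM = M%:cM.
  by apply/matrixP => i j; rewrite !mxE comp_polyC.
pose X' := map_mx (comp_poly (- 'X)) X; pose P' := map_mx (comp_poly (- 'X)) P.
have PX : P *m X = a%:M by rewrite mul_adj_mx.
have PX' : X'^T *m P'^T = (para a)%:M.
  by rewrite -trmx_mul -map_mxM PX map_scalar_mx tr_scalar_mx.
have X'E : X' = - 'X%:M - F%:cM.
  by rewrite /X' /X /char_poly_mx map_mxB para_cM map_scalar_mx /= comp_polyX
    raddfN.
have key : X *m S%:cM + S%:cM *m X'^T =
    V%:P *: (E%:cM *m E%:cM^T) - W%:P *: (L%:cM *m L%:cM^T).
  rewrite X'E /X /char_poly_mx mulmxBl linearB linearN /= tr_scalar_mx mulmxBr.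
  rewrite mulmxN mul_scalar_mx mul_mx_scalar addrACA subrr add0r.
  rewrite -opprD !map_trmx -!map_mxM -map_mxD lyap -map_mxN opprB.
  by rewrite map_mxB !map_mxZ.
have num' G : (G%:cM^T *m P'^T *m (H%:cM)^T) = (para (tf_num F G H))%:M.
  rewrite -mulmxA -!trmx_mul -(para_cM _ _ G) -(para_cM _ _ H).
  rewrite -!map_mxM [X in X^T]mx11_scalar tr_scalar_mx; congr _%:M.
  by rewrite mxE.
have num G : H%:cM *m P *m G%:cM = (tf_num F G H)%:M
  by rewrite [LHS]mx11_scalar.
have lhs1 : H%:cM *m (P *m (X *m S%:cM) *m P'^T) *m H%:cM^T
     = (a * (W%:P * para l))%:M.
  rewrite [P *m _]mulmxA PX mul_scalar_mx -scalemxAl -scalemxAr -scalemxAl.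
  rewrite !mulmxA -map_mxM HS map_mxZ -map_trmx -!scalemxAl num'.
  by rewrite !scale_scalar_mx.
have lhs2 : H%:cM *m (P *m (S%:cM *m X'^T) *m P'^T) *m H%:cM^T
     = (para a * (W%:P * l))%:M.
  rewrite [P *m _]mulmxA -[_ *m X'^T *m _]mulmxA PX' mul_mx_scalar.
  rewrite -scalemxAr -scalemxAl -!mulmxA map_trmx -map_mxM SH map_mxZ.
  by rewrite -!scalemxAr mulmxA num !scale_scalar_mx.
have rhs G c : H%:cM *m (P *m (c%:P *: (G%:cM *m G%:cM^T)) *m P'^T) *m H%:cM^T
     = (c%:P * (tf_num F G H * para (tf_num F G H)))%:M.
  rewrite -scalemxAr -scalemxAl -scalemxAr -scalemxAl !mulmxA num.
  rewrite -!mulmxA mul_scalar_mx [_ *m (_ *m _)]mulmxA num'.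
  by rewrite !scale_scalar_mx.
have : (a * (W%:P * para l))%:M + (para a * (W%:P * l))%:M =
       (V%:P * (e * para e))%:M - (W%:P * (l * para l))%:M :> 'M_1.
  rewrite -lhs1 -lhs2 -!rhs -mulmxDl -mulmxDr -mulmxDl -mulmxDr key.
  by rewrite mulmxBr mulmxBl mulmxBr mulmxBl.
rewrite -raddfD -raddfB => /matrixP/(_ 0 0); rewrite !mxE /= => eq_al.
rewrite /f char_poly_feedback -/a -/e -/l rmorphD /= -!mul_polyC.
rewrite !mulr1n in eq_al; apply/eqP; rewrite -subr_eq0; apply/eqP.
move/eqP: eq_al; rewrite -subr_eq0 => /eqP <-.
by ring.
Qed.

(** * Hermitian forms and Lyapunov operators *)

Section Hermitian.
Variable R : realType.
Implicit Types (p m : nat).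
Local Notation C := R[i].

Lemma conj_toC p m (M : 'M[R]_(p, m)) : map_mx conjc (toC R M) = toC R M.
Proof. by apply/matrixP => i j; rewrite !mxE conjc_real. Qed.

Lemma herm_mul p m q (M : 'M[C]_(p, m)) (K : 'M[C]_(m, q)) :
  (M *m K)^h = K^h *m M^h.
Proof. by rewrite map_mxM trmx_mul. Qed.

Lemma herm_toC p m (M : 'M[R]_(p, m)) : (toC R M)^h = toC R M^T.
Proof. by rewrite conj_toC map_trmx. Qed.

(** The form is [|v G|^2]. *)
Lemma herm_square p (v : 'rV[C]_p) (G : 'cV[R]_p) :
  exists q : R, [/\ 0 <= q, q = 0 -> v *m toC R G = 0 &
    v *m toC R (G *m G^T) *m v^h = (real_complex R q)%:M].
Proof.
set g := (v *m toC R G) 0 0.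
have gE : v *m toC R G = g%:M by exact: mx11_scalar.
exists (complex.Re g ^+ 2 + complex.Im g ^+ 2); split.
- by rewrite addr_ge0 ?sqr_ge0.
- move/eqP; rewrite paddr_eq0 ?sqr_ge0 // !sqrf_eq0 gE => /andP[/eqP re0 /eqP
  im0].
  have -> : g = 0 by apply/eqP; rewrite eq_complex /= re0 im0 !eqxx.
  by rewrite raddf0.
- rewrite map_mxM mulmxA -mulmxA -herm_toC -herm_mul gE.
  rewrite map_scalar_mx tr_scalar_mx -scalar_mxM; congr _%:M.
  case: (g) => a b; apply/eqP; rewrite eq_complex /=.
  by apply/andP; split; apply/eqP; ring.
Qed.

Lemma posdef_ge0 p (S : 'M[R]_p) (x : 'rV[R]_p) :
  posdef S -> 0 <= (x *m S *m x^T) 0 0 ?= iff (x == 0).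
Proof.
move=> [_ posS]; have [-> | x0] := eqVneq x 0.
  by apply/leifP; rewrite !mul0mx mxE.
apply/leifP; have := posS x^T; rewrite trmxK; apply.
by rewrite -(inj_eq trmx_inj) trmxK trmx0.
Qed.

(** A real symmetric form takes the value [x S x^T + y S y^T] at [x + i y],
since the cross terms cancel. *)
Lemma posdef_herm p (S : 'M[R]_p) (v : 'rV[C]_p) :
  posdef S -> v != 0 ->
  exists2 q : R, 0 < q & v *m toC R S *m v^h = (real_complex R q)%:M.
Proof.
move=> posS v0; have symS := posS.1.
pose x := map_mx (@complex.Re R) v; pose y := map_mx (@complex.Im R) v.
have vE : v = toC R x + 'i%C *: toC R y.
  by apply/matrixP => i j; rewrite !mxE -complexE.
exists ((x *m S *m x^T) 0 0 + (y *m S *m y^T) 0 0).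
  have x1 := posdef_ge0 x posS; have y1 := posdef_ge0 y posS.
  rewrite lt0r addr_ge0 ?x1 ?y1 // paddr_eq0 ?x1 ?y1 //.
  rewrite ![_ == 0]eq_sym x1.2 y1.2 andbT;
    apply: contra v0 => /andP[/eqP x0 /eqP y0].
  by rewrite vE x0 y0 !map_mx0 scaler0 addr0.
have sym : y *m S *m x^T = x *m S *m y^T.
  by rewrite [LHS]mx11_scalar -[LHS]tr_scalar_mx -mx11_scalar !trmx_mul trmxK
    symS mulmxA.
have vhE : v^h = toC R x^T - 'i%C *: toC R y^T.
  apply/matrixP => i j; rewrite !mxE; case: (v _ _) => a b; apply/eqP;
    rewrite eq_complex /=.
  by apply/andP; split; apply/eqP; ring.
rewrite vhE {1}vE mulmxDl mulmxDl !mulmxBr -!scalemxAl -!scalemxAr -!map_mxM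
  sym.
rewrite scalerA -expr2 sqr_i scaleN1r opprK addrA subrK -map_mxD.
by rewrite [X in map_mx _ X]mx11_scalar map_scalar_mx /= mxE.
Qed.

Lemma posdef_unit p (S : 'M[R]_p) : posdef S -> S \in unitmx.
Proof.
move=> posS; rewrite -row_free_unit -kermx_eq0; apply/eqP/row_matrixP => i.
rewrite row0; apply/eqP; rewrite -(posdef_ge0 (row i (kermx S)) posS).2.
by rewrite -row_mul mulmx_ker row0 mul0mx mxE.
Qed.

(** On a left eigenvector the Lyapunov operator acts as [2 Re z]: this is what
ties the sign of a Lyapunov equation to the location of the spectrum. *)
Lemma lyapunov_form p (F S : 'M[R]_p) (v : 'rV[C]_p) (z : C) :
  v *m toC R F = z *: v ->
  v *m toC R (F *m S + S *m F^T) *m v^h =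
    (z + conjc z) *: (v *m toC R S *m v^h).
Proof.
move=> vF; rewrite map_mxD mulmxDr mulmxDl !map_mxM !mulmxA vF scalerDl.
by rewrite -!scalemxAl -herm_toC -[X in _ + X]mulmxA -herm_mul vF map_mxZ
  linearZ /= -scalemxAr.
Qed.

(** The same identity for a right eigenvector [u] of [F], taken as [u^T = w S].
*)
Lemma lyapunov_form_dual p (F S : 'M[R]_p) (w : 'rV[C]_p) (z : C) :
  S^T = S -> (w *m toC R S) *m toC R F^T = z *: (w *m toC R S) ->
  w *m toC R (F *m S + S *m F^T) *m w^h =
    (z + conjc z) *: (w *m toC R S *m w^h).
Proof.
move=> symS wF; rewrite map_mxD mulmxDr mulmxDl !map_mxM !mulmxA wF scalerDl.
rewrite addrC -scalemxAl; congr (_ + _).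
have Sw : toC R S *m w^h = (w *m toC R S)^h by rewrite herm_mul herm_toC symS.
have FSw : toC R F *m (toC R S *m w^h) = (w *m toC R S *m toC R F^T)^h.
  by rewrite [RHS]herm_mul herm_toC trmxK Sw.
by rewrite -!mulmxA FSw wF map_mxZ linearZ /= -scalemxAr Sw.
Qed.

Lemma real_scalar_eq (z : C) (q r : R) :
  ((z + conjc z) * real_complex R q)%:M = (real_complex R r)%:M :> 'M_1 ->
  (complex.Re z + complex.Re z) * q = r.
Proof.
move=> /matrixP/(_ 0 0); rewrite !mxE /= !mulr1n.
by case: z => a b /= [<- _]; rewrite mulr0 subr0.
Qed.
End Hermitian.

(** * Controllability, observability and eigenvectors *)

Section Kalman.
Variable R : realType.
Implicit Types (p m q : nat).

Lemma left_eigen_pow p (F : 'M[R]_p) (v : 'rV[R[i]]_p) z k :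
  v *m toC R F = z *: v -> v *m toC R (F ^+ k) = z ^+ k *: v.
Proof.
move=> vF; elim: k => [|k IH]; first by rewrite !expr0 map_mx1 mulmx1 scale1r.
by rewrite exprS -mulmxE map_mxM mulmxA vF -scalemxAl IH scalerA exprS.
Qed.

(** The easy half of the Popov-Belevitch-Hautus test: a left eigenvector that
annihilates [G] annihilates the whole Kalman matrix. *)
Lemma controllable_left_eigen p m (F : 'M[R]_p) (G : 'M[R]_(p, m))
    (v : 'rV[R[i]]_p) z :
  controllable F G -> v *m toC R F = z *: v -> v *m toC R G = 0 -> v = 0.
Proof.
move=> ctr vF vG; apply/eqP.
have free : row_free (toC R (\mxrow_(i < p) (F ^+ i *m G))).
  by rewrite /row_free mxrank_map; apply/eqP.
rewrite -(mulmx_free_eq0 v free).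
have -> : toC R (\mxrow_(i < p) (F ^+ i *m G))
          = \mxrow_(i < p) toC R (F ^+ i *m G).
  by apply/matrixP => i j; rewrite !mxE.
rewrite mul_mxrow; apply/eqP; rewrite -[RHS](@mxrow0 _ _ (fun=> m)).
apply: eq_mxrow => i.
by rewrite map_mxM mulmxA (left_eigen_pow _ vF) -scalemxAl vG scaler0.
Qed.

Lemma trmx_pow p (F : 'M[R]_p) k : (F ^+ k)^T = F^T ^+ k.
Proof.
elim: k => [|k IH]; first by rewrite !expr0 trmx1.
by rewrite exprS exprSr -mulmxE trmx_mul IH.
Qed.

Lemma observable_dual p q (F : 'M[R]_p) (H : 'M[R]_(q, p)) :
  observable F H -> controllable F^T H^T.
Proof.
rewrite /observable /controllable -mxrank_tr tr_mxcol => obs.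
have <- : \mxrow_(i < p) (H *m F ^+ i)^T = \mxrow_(i < p) (F^T ^+ i *m H^T).
  by apply: eq_mxrow => i; rewrite trmx_mul trmx_pow.
by [].
Qed.

Lemma controllable_kernel p m (F : 'M[R]_p) (G : 'M[R]_(p, m)) :
  (forall v : 'rV[R]_p,
     (forall i, (i < p)%N -> v *m (F ^+ i *m G) = 0) -> v = 0) ->
  controllable F G.
Proof.
move=> ker0; apply/eqP; change (row_free (\mxrow_(i < p) (F ^+ i *m G))).
rewrite -kermx_eq0; apply/eqP/row_matrixP => k; rewrite row0.
apply: ker0 => i lt_ip.
have : row k (kermx (\mxrow_(i < p) (F ^+ i *m G)))
       *m \mxrow_(i < p) (F ^+ i *m G) = 0.
  by rewrite -row_mul mulmx_ker row0.
by rewrite mul_mxrow -[X in _ = X -> _](@mxrow0 _ _ (fun=> m)) =>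
  /eq_mxrowP/(_ (Ordinal lt_ip)).
Qed.

Lemma eigenvalP p (F : 'M[R]_p) z :
  reflect (exists2 v : 'rV[R[i]]_p, v *m toC R F = z *: v & v != 0)
          (eigenval F z).
Proof. exact: eigenvalueP. Qed.

Lemma eigenval_root p (F : 'M[R]_p) z :
  eigenval F z = root (toCp R (char_poly F)) z.
Proof. by rewrite /eigenval eigenvalue_root_char map_char_poly. Qed.

Lemma char_poly_tr p (F : 'M[R]_p) : char_poly F^T = char_poly F.
Proof.
rewrite /char_poly -det_tr; congr (\det _).
by rewrite /char_poly_mx linearB /= tr_scalar_mx map_trmx trmxK.
Qed.

Lemma disjoint_coprime p q (F : 'M[R]_p) (G : 'M[R]_q) :
  disjoint_spectra F G -> coprimep (char_poly F) (char_poly G).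
Proof.
move=> dis; apply: coprimep_no_common_root => z; rewrite -!eigenval_root => Fz.
by apply/negP => Gz; apply: (dis z).
Qed.

(** If [v F^i G = 0] for all [i < p], then [F] and [K = F - G H] have the same
powers along [v], up to exponent [p], hence [v char_poly_F(K) = v char_poly_F(F)
= 0].  But [char_poly_F(K)] is invertible, because [char_poly F] is coprime to
[char_poly K], which vanishes at [K]; so [v = 0]. *)
Lemma disjoint_controllable p (F : 'M[R]_p) (G : 'cV[R]_p) (H : 'rV[R]_p) :
  (0 < p)%N -> disjoint_spectra F (F - G *m H) -> controllable F G.
Proof.
case: p F G H => [|p] // F G H _ dis; apply: controllable_kernel => v vG.
set K := F - G *m H in dis.
have pow i : (i <= p.+1)%N -> v *m F ^+ i = v *m K ^+ i.
  elim: i => [|i IH] lti; first by rewrite !expr0.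
  rewrite !exprSr -!mulmxE !mulmxA -IH ?(ltnW lti) //.
  by rewrite /K mulmxBr (mulmxA _ G) -(mulmxA v _ G) vG // mul0mx subr0.
have horn (M : 'M[R]_p.+1) : horner_mx M (char_poly F) =
    \sum_(i < p.+2) (char_poly F)`_i *: M ^+ i.
  rewrite -[in LHS](coefK (char_poly F)) poly_def rmorph_sum size_char_poly /=.
  by apply: eq_bigr => i _; rewrite horner_mxZ rmorphXn /= horner_mx_X.
have vK : v *m horner_mx K (char_poly F) = 0.
  rewrite -[RHS](mulmx0 _ v) -(Cayley_Hamilton F) !horn !mulmx_sumr.
  by apply: eq_bigr => i _; rewrite -!scalemxAr pow // -ltnS.
have /Bezout_eq1_coprimepP[[a b] /= ab1] := disjoint_coprime dis.
rewrite -[LHS]mulmx1 -[1%:M](rmorph1 (horner_mx K)) -ab1 rmorphD !rmorphM /=.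
by rewrite Cayley_Hamilton mulr0 addr0 comm_horner_mx2 -mulmxE mulmxA vK mul0mx.
Qed.

End Kalman.

(** Pair a left eigenvector [v] of [F] with a right eigenvector [u] of
[F - G H] for the same [z]: since [v (z - F) u = 0], the product
[(v G) (H u)] vanishes.  If [H u = 0], then [u] is an unobservable eigenvector
of [F]; hence [v G = 0].  The transpose of [u] is the row [r] of the proof. *)
Lemma common_eigenvalue_uncontrollable (R : realType) p (F : 'M[R]_p)
    (G : 'cV[R]_p) (H : 'rV[R]_p) z :
  observable F H -> eigenval F z -> eigenval (F - G *m H) z ->
  uncontrollable_eigenvalue F G z.
Proof.
move=> obs /eigenvalP[v vF v0].
rewrite eigenval_root -char_poly_tr -eigenval_root => /eigenvalP[r rK r0].
have rF : r *m toC R F^T = z *: r + (r *m toC R H^T) *m toC R G^T.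
  by rewrite -rK linearB /= trmx_mul map_mxB mulmxBr map_mxM mulmxA subrK.
have vG0 : v *m toC R G = 0.
  have eq0 : (r *m toC R H^T) *m (v *m toC R G)^T = 0.
    have := congr1 (mulmx^~ v^T) rF.
    rewrite mulmxDl -scalemxAl -!mulmxA -!map_trmx -!trmx_mul vF.
    rewrite linearZ /= -scalemxAr => /eqP.
    by rewrite -[X in X == _]addr0 (inj_eq (addrI _)) => /eqP.
  move: eq0; rewrite [r *m _]mx11_scalar mul_scalar_mx => /eqP.
  rewrite scalemx_eq0 => /orP[|/eqP vG]; last by rewrite -[LHS]trmxK vG trmx0.
  move=> /eqP rH0; case/eqP: r0.
  have rH : r *m toC R H^T = 0 by rewrite [LHS]mx11_scalar rH0 raddf0.
  apply: (controllable_left_eigen (observable_dual obs) _ rH).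
  by rewrite rF rH mul0mx addr0.
rewrite /uncontrollable_eigenvalue ltn_neqAle rank_leq_row andbT.
apply: contra v0 => free; rewrite -(mulmx_free_eq0 v free).
by rewrite mul_mx_row vG0 mulmxBr vF mul_mx_scalar subrr row_mx0.
Qed.

(** * Location of the eigenvalues in the Riccati equation *)

Section Riccati.
Variables (R : realType) (p : nat) (F : 'M[R]_p) (E : 'cV[R]_p) (H : 'rV[R]_p).
Variables (V W : R) (S : 'M[R]_p).
Hypotheses (W0 : 0 < W) (posS : posdef S) (ric : filter_riccati F E H V W S).
Let L := W^-1 *: (S *m H^T).

Lemma riccati_open_loop :
  F *m S + S *m F^T = W^-1 *: ((S *m H^T) *m (S *m H^T)^T) - V *: (E *m E^T).
Proof.
have HS : H *m S = (S *m H^T)^T by rewrite trmx_mul trmxK posS.1.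
move: ric; rewrite /filter_riccati -[_ *m H *m S]mulmxA HS => /esym/eqP.
by rewrite subr_eq0 => /eqP <-; rewrite addrK.
Qed.

Lemma riccati_closed_loop :
  (F - L *m H) *m S + S *m (F - L *m H)^T =
    - (V *: (E *m E^T) + W *: (L *m L^T)).
Proof.
have LHS' : L *m H *m S = W *: (L *m L^T).
  have HS : H *m S = W *: L^T.
    by rewrite /L linearZ /= trmx_mul trmxK posS.1 scalerA divff ?gt_eqF //
      scale1r.
  by rewrite -mulmxA HS scalemxAr.
have SLH : S *m (L *m H)^T = W *: (L *m L^T).
  by rewrite -{1}posS.1 -trmx_mul LHS' linearZ /= trmx_mul trmxK.
rewrite linearB /= mulmxBl mulmxBr addrACA riccati_open_loop LHS' SLH.
have -> : W^-1 *: (S *m H^T *m (S *m H^T)^T) = W *: (L *m L^T).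
  rewrite /L linearZ /= -scalemxAl -scalemxAr !scalerA divff ?gt_eqF //.
  by rewrite mul1r.
by rewrite -opprD addrAC opprD addrA subrr sub0r opprD addrC.
Qed.

(** If [V = 0], the equation reads [F S + S F^T = W^-1 S H^T H S], whose
right-hand side is positive semidefinite; together with [0 < S] this leaves [F]
no eigenvalue with negative real part. *)
Lemma riccati_driven z : 0 <= V -> eigenval F z -> complex.Re z < 0 -> 0 < V.
Proof.
move=> V_ge0 Fz z_lt0; rewrite lt0r V_ge0 andbT; apply/negP => /eqP V0.
have /eigenvalP[r rF r0] : eigenval F^T z.
  by rewrite eigenval_root char_poly_tr -eigenval_root.
pose w := r *m toC R (invmx S).
have wS : w *m toC R S = r.
  by rewrite -mulmxA -map_mxM mulVmx ?posdef_unit // map_mx1 mulmx1.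
have w0 : w != 0 by apply: contra r0 => /eqP w0; rewrite -wS w0 mul0mx.
have [q q_gt0 qE] := posdef_herm posS w0.
have [s [s_ge0 _ sE]] := herm_square w (S *m H^T).
have := lyapunov_form_dual (F := F) (w := w) (z := z) posS.1.
rewrite wS => /(_ rF); rewrite riccati_open_loop V0 scale0r subr0 map_mxZ.
rewrite -scalemxAr -scalemxAl sE -wS qE !scale_scalar_mx -rmorphM =>
  /esym/real_scalar_eq e.
have : 0 <= W^-1 * s by rewrite mulr_ge0 // invr_ge0 ltW.
by rewrite -e leNgt pmulr_llt0 // -mulr2n pmulrn_llt0 // z_lt0.
Qed.

(** Lyapunov's argument: a left eigenvector [v] of the closed loop with
[0 <= Re z] would have [v E = 0] and [v L = 0], hence be a left eigenvector of
[F] annihilating [E]. *)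
Lemma riccati_closed_loop_hurwitz :
  0 < V -> controllable F E -> hurwitz (char_poly (F - L *m H)).
Proof.
(* [L] is generalised to hide its scalar factor from the rewrites below. *)
move: riccati_closed_loop; move: (L) => K clo V0 ctr z;
  rewrite -eigenval_root => /eigenvalP[v vF v0].
rewrite ltNge; apply/negP => z_ge0.
have [q q_gt0 qE] := posdef_herm posS v0.
have [e [e_ge0 e0 eE]] := herm_square v E.
have [l [l_ge0 l0 lE]] := herm_square v K.
have := lyapunov_form S vF; rewrite clo map_mxN map_mxD !map_mxZ.
rewrite mulmxN mulNmx mulmxDr mulmxDl -!scalemxAr -!scalemxAl eE lE qE.
rewrite !scale_scalar_mx -!rmorphM -raddfD -raddfN -rmorphD -rmorphN.
move=> /esym/real_scalar_eq eq.
have Ve : 0 <= V * e by rewrite mulr_ge0 // ltW.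
have Wl : 0 <= W * l by rewrite mulr_ge0 // ltW.
have : 0 <= (complex.Re z + complex.Re z) * q
  by rewrite mulr_ge0 ?addr_ge0 // ltW.
rewrite eq oppr_ge0 => le0.
have /eqP : V * e + W * l == 0 by rewrite eq_le le0 addr_ge0.
move=> /eqP; rewrite paddr_eq0 // !mulf_eq0 (gt_eqF V0) (gt_eqF W0) /=.
move=> /andP[/eqP/e0 vE /eqP/l0 vL].
have vA : v *m toC R F = z *: v.
  by rewrite -vF map_mxB mulmxBr map_mxM mulmxA vL mul0mx subr0.
by move: v0; rewrite (controllable_left_eigen ctr vA vE) eqxx.
Qed.
End Riccati.

(** * The augmented filter *)

Theorem mainTheorem7 (R : realType) (n N : nat) (n_ge1 : (1 <= n)%N)
  (N_ge1 : (1 <= N)%N) (tau : R) (tau_gt0 : 0 < tau)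
  (A : 'M[R]_n) (B E : 'cV[R]_n) (C : 'rV[R]_n)
  (obsAC : observable A C) (ctrAB : controllable A B)
  (ctrAE : controllable A E)
  (V W : R) (V_ge0 : 0 <= V) (W_gt0 : 0 < W)
  (A_N : 'M[R]_N) (B_N : 'cV[R]_N) (C_N : 'rV[R]_N) (D_N : 'M[R]_1)
  (pade_real : minimal_realization A_N B_N C_N D_N (pade N tau)%:M) :
  let A_aug : 'M[R]_(n + N) := block_mx A 0 (B_N *m C) A_N in
  let E_aug : 'cV[R]_(n + N) := col_mx E 0 in
  let C_aug : 'rV[R]_(n + N) := row_mx (D_N *m C) C_N in
  forall (obs_aug : observable A_aug C_aug)
    (ctr_aug : controllable A_aug E_aug)
    (Sigma_aug : 'M[R]_(n + N))
    (Sigma_augP : unique_posdef_solution A_aug E_aug C_aug V W Sigma_aug)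
    (Sigma : 'M[R]_n)
    (SigmaP : unique_posdef_solution A E C V W Sigma),
  let L_aug : 'cV[R]_(n + N) := W^-1 *: (Sigma_aug *m C_aug^T) in
  let A_aug_CL : 'M[R]_(n + N) := A_aug - L_aug *m C_aug in
  let L : 'cV[R]_n := W^-1 *: (Sigma *m C^T) in
  forall (disj_AN_A : disjoint_spectra A_N A)
    (disj_AN_ALC : disjoint_spectra A_N (A - L *m C))
    (disj_A_ALC : disjoint_spectra A (A - L *m C)),
  (forall lambda : R[i], eigenval A_N lambda ->
     eigenval A_aug_CL lambda /\ uncontrollable_eigenvalue A_aug L_aug lambda)
  /\ minimal_realization A L C 0 (transfer A_aug L_aug C_aug 0).
Proof.
move=> A_aug E_aug C_aug obs_aug ctr_aug Sigma_aug [[posSa ricSa] _].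
move=> Sigma [[posS ricS] _] L_aug A_aug_CL L _ _ disj_A_ALC.
have [tfN _ _] := pade_real.
have [hur_AN allpass] := pade_realization_allpass tau_gt0 tfN.
have W0 : W != 0 by rewrite gt_eqF.
have ch_aug : char_poly A_aug = char_poly A * char_poly A_N.
  exact: char_poly_lblock.
have eig_aug z : eigenval A_N z -> eigenval A_aug z.
  by rewrite !eigenval_root ch_aug rmorphM rootM => ->; rewrite orbT.
have V_gt0 : 0 < V.
  have /closed_rootP[z z_root] : size (toCp R (char_poly A_N)) != 1%N.
    by rewrite size_map_poly size_char_poly; case: (N) N_ge1.
  apply: (riccati_driven W_gt0 posSa ricSa V_ge0 _ (hur_AN z z_root)).
  by apply: eig_aug; rewrite eigenval_root.
have hur_f : hurwitz (char_poly (A - L *m C)).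
  exact: riccati_closed_loop_hurwitz W_gt0 posS ricS V_gt0 ctrAE.
have hur_fa : hurwitz (char_poly A_aug_CL).
  exact: riccati_closed_loop_hurwitz W_gt0 posSa ricSa V_gt0 ctr_aug.
have spec := riccati_spectral_factorization W0 posS.1 ricS.
have speca := riccati_spectral_factorization W0 posSa.1 ricSa.
rewrite -/L_aug -/A_aug_CL ch_aug tf_num_cascade allpass !rmorphM /= paraK in
  speca.
rewrite -/L /= in spec.
have ch_CL : char_poly A_aug_CL = char_poly (A - L *m C) * char_poly A_N.
  apply: spectral_factor_unique => //; rewrite ?monicMl ?char_poly_monic //.
    exact: hurwitz_mul.
  (* Both sides are [a_N a_N~] times the factorisation for the plant. *)
  apply: (scalerI W0).
  rewrite speca rmorphM /= [in RHS]mulrACA [RHS]scalerAl spec mulrDl -!scalerAl.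
  rewrite [in LHS]mulrACA; congr (_ + V *: _).
  by rewrite mulrACA mulrC [X in _ * X]mulrC.
split=> [z Nz|].
  have CLz : eigenval A_aug_CL z.
    by rewrite eigenval_root ch_CL rmorphM rootM -!eigenval_root Nz orbT.
  split=> //; apply: common_eigenvalue_uncontrollable obs_aug _ CLz.
  exact: eig_aug.
split=> //; last exact: disjoint_controllable n_ge1 disj_A_ALC.
have num_fb p (F : 'M[R]_p) G H :
    tf_num F G H = char_poly (F - G *m H) - char_poly F.
  by rewrite char_poly_feedback addrC addKr.
rewrite !transferE !mxE !scale0r !addr0 !num_fb -/A_aug_CL ch_CL ch_aug -mulrBl.
congr _%:M; rewrite !rmorphM /= invfM mulrACA divff ?mulr1 //.
by rewrite tofrac_eq0 monic_neq0 ?char_poly_monic.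
Qed.
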